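(* Let $G$ be a connected non-complete graph of order $n$ with $4\leq n\leq 8$. If $C(G)$ is a linear forest and $\delta(G)\geq 2$, then $cfc(G) = 2$.
   Context: All graphs are finite, simple and undirected; $\delta(G)$ is the minimum degree. For a graph $G$, $C(G)$ denotes the subgraph of $G$ induced by the set of cut-edges of $G$. A linear forest is a forest each of whose components is a path (an edgeless graph counts). An edge-coloring of a connected graph (adjacent edges may receive the same color) is a conflict-free connection coloring if every pair of distinct vertices is joined by a path containing at least one color used on exactly one edge of that path. The conflict-free connection number $cfc(G)$ is the smallest number of colors in a conflict-free connection coloring of $G$. *)

(* Defs.v *)
From HB Require Import structures.
From mathcomp Require Import all_boot.

Set Implicit Arguments.
Unset Strict Implicit.
Unset Printing Implicit Defensive.

Record sgraph := SGraph {
  svertex :> finType;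
  adj : rel svertex;
  adj_sym : symmetric adj;
  adj_irr : irreflexive adj }.
Arguments adj {s} _ _.

Section Basic.
Variable G : sgraph.

Definition complete : Prop := forall x y : G, x != y -> adj x y.

Definition connected : Prop := forall x y : G, connect adj x y.

Definition degree (x : G) : nat := #|[set y | adj x y]|.

(* Every degree is less than #|G|, so the neutral element does not affect the
   minimum as long as G has a vertex. *)
Definition min_degree : nat := \big[minn/#|G|]_(x : G) degree x.

Definition edges : {set {set G}} :=
  [set [set p.1; p.2] | p : G * G & adj p.1 p.2].

Definition component (x : G) : {set G} := [set y | connect adj x y].

Definition num_components : nat := n_comp (@adj G) predT.

(* In ucycle, a traversed edge x, y, x counts as a cycle of size 2. *)
Definition forest : Prop :=
  forall c : seq G, 2 < size c -> ~ ucycle adj c.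

Definition path_graph : Prop :=
  exists (m : nat) (f : 'I_m -> G), bijective f /\
    forall i j : 'I_m,
      adj (f i) (f j) = (i.+1 == j :> nat) || (j.+1 == i :> nat).

End Basic.

Section Subgraphs.
Variable G : sgraph.

Section Induced.
Variable A : {set G}.

Definition induced_adj : rel {x : G | x \in A} :=
  fun x y => adj (val x) (val y).

Lemma induced_sym : symmetric induced_adj.
Proof. by move=> x y; apply: adj_sym. Qed.

Lemma induced_irr : irreflexive induced_adj.
Proof. by move=> x; apply: adj_irr. Qed.

Definition induced : sgraph := SGraph induced_sym induced_irr.
End Induced.

Section EdgeDeletion.
Variable e : {set G}.

Definition del_edge_adj : rel G := fun x y => adj x y && ([set x; y] != e).

Lemma del_edge_sym : symmetric del_edge_adj.
Proof. by move=> x y; rewrite /del_edge_adj adj_sym setUC. Qed.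

Lemma del_edge_irr : irreflexive del_edge_adj.
Proof. by move=> x; rewrite /del_edge_adj adj_irr. Qed.

Definition del_edge : sgraph := SGraph del_edge_sym del_edge_irr.
End EdgeDeletion.

Section EdgeInduced.
Variable F : {set {set G}}.

Definition edge_induced_adj : rel {x : G | x \in cover F} :=
  fun x y => adj (val x) (val y) && ([set val x; val y] \in F).

Lemma edge_induced_sym : symmetric edge_induced_adj.
Proof. by move=> x y; rewrite /edge_induced_adj adj_sym setUC. Qed.

Lemma edge_induced_irr : irreflexive edge_induced_adj.
Proof. by move=> x; rewrite /edge_induced_adj adj_irr. Qed.

Definition edge_induced : sgraph := SGraph edge_induced_sym edge_induced_irr.
End EdgeInduced.

Definition cut_edges : {set {set G}} :=
  [set e in edges G | num_components G < num_components (del_edge e)].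

Definition cut_edge_graph : sgraph := edge_induced cut_edges.

Definition linear_forest : Prop :=
  forest G /\ forall x : G, path_graph (induced (component x)).

End Subgraphs.

Section ConflictFree.
Variable G : sgraph.

(* The path with vertices x :: p. *)
Definition path_edges (x : G) (p : seq G) : seq {set G} :=
  pairmap (fun y z : G => [set y; z]) x p.

(* Only the values of a coloring on edges G are ever used. *)
Definition conflict_free_path (c : {set G} -> nat) (x y : G) (p : seq G) : Prop :=
  [/\ path adj x p, last x p = y, uniq (x :: p)
    & exists a : nat, count_mem a (map c (path_edges x p)) = 1].

Definition cfc_coloring (c : {set G} -> nat) : Prop :=
  forall x y : G, x != y -> exists p : seq G, conflict_free_path c x y p.

Definition num_colors (c : {set G} -> nat) : nat :=
  size (undup [seq c e | e in edges G]).

(* cfc(G) = k. *)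
Definition is_cfc (k : nat) : Prop :=
  (exists c, cfc_coloring c /\ num_colors c = k) /\
  (forall c, cfc_coloring c -> k <= num_colors c).

End ConflictFree.

(* Main.v *)
Require Import Defs.
From HB Require Import structures.
From mathcomp Require Import all_boot.

Set Implicit Arguments.
Unset Strict Implicit.
Unset Printing Implicit Defensive.

(** Mark some edges and give the marked and unmarked edges different colours;
    a path with exactly one mark is conflict-free.  Call a vertex set versatile
    if any two of its vertices are joined inside it both by an unmarked path
    and by a path with one mark.  Versatility survives adding an ear, so it
    holds for a single vertex, then for every bridgeless piece of the graph.

    If the graph has a bridge, pick an inclusion-minimal side [U] of a bridge
    and an inclusion-minimal side [W] of a bridge in the complement of [U].
    Both are bridgeless and, as all degrees are at least 2, have at least 3
    vertices.  So at most 2 vertices remain, and these form a (possibly empty)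
    path of bridges from [U] to [W]; marking a suitable edge of this path
    completes the colouring. *)

(** * Simple paths with a prescribed number of marked edges *)

Section MarkedPaths.
Variable G : sgraph.
Implicit Types (F : pred {set G}) (A B S : {set G}) (x y z : G) (p : seq G).

Lemma disjointsUl A B S :
  [disjoint A :|: B & S] = [disjoint A & S] && [disjoint B & S].
Proof. by rewrite -!setI_eq0 setIUl setU_eq0. Qed.

Lemma mem_cat_cons (T : eqType) (x : T) (s : seq T) :
  x \in s -> exists s1 s2, s = s1 ++ x :: s2.
Proof. by case/splitPr => s1 s2; exists s1, s2. Qed.

Definition marked_path F A k x y : Prop :=
  exists p, [/\ path adj x p, last x p = y, uniq (x :: p),
    {subset x :: p <= A} & count F (path_edges x p) = k].

Lemma path_edges_cat x p1 p2 :
  path_edges x (p1 ++ p2) = path_edges x p1 ++ path_edges (last x p1) p2.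
Proof. by rewrite /path_edges pairmap_cat. Qed.

Lemma count_path_edges_rev F x p :
  count F (path_edges (last x p) (rev (belast x p))) = count F (path_edges x p).
Proof.
elim: p x => [|y p IHp] x //=.
rewrite rev_cons -cats1 path_edges_cat count_cat IHp /=.
suff -> : last (last y p) (rev (belast y p)) = y by rewrite setUC addn0 addnC.
by case: p {IHp} => //= z p; rewrite rev_cons last_rcons.
Qed.

Lemma marked_path_refl F A x : x \in A -> marked_path F A 0 x x.
Proof. by move=> Ax; exists [::]; split=> // y; rewrite inE => /eqP->. Qed.

Lemma marked_path_sym F A k x y : marked_path F A k x y -> marked_path F A k y x.
Proof.
case=> p [pth <- Up sA <-].
have E : last x p :: rev (belast x p) = rev (x :: p).
  by rewrite [in RHS]lastI rev_rcons.
exists (rev (belast x p)); split.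
- by rewrite rev_path (eq_path (e' := adj)) // => u v; rewrite adj_sym.
- by case: p {pth Up sA E} => //= z p; rewrite rev_cons last_rcons.
- by rewrite E rev_uniq.
- by rewrite E => z; rewrite mem_rev; apply: sA.
- exact: count_path_edges_rev.
Qed.

(** Disjointness of [A] and [B] keeps the concatenation simple. Longer routes below are assembled
    from pieces in this way. *)
Lemma marked_path_step F A B k i j x y z w :
  [disjoint A & B] -> marked_path F A i x y -> adj y z ->
  marked_path F B j z w -> k = i + F [set y; z] + j ->
  marked_path F (A :|: B) k x w.
Proof.
move=> dAB [p [pp lp Up sp <-]] yz [q [pq lq Uq sq <-]] ->.
exists (p ++ z :: q); split.
- by rewrite cat_path /= lp pp yz.
- by rewrite last_cat.
- rewrite -cat_cons cat_uniq Up Uq andbT.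
  apply/hasPn => v /sq Bv; apply/negP => /sp Av.
  by move: (disjointFr dAB Av); rewrite Bv.
- move=> v; rewrite -cat_cons mem_cat in_setU.
  by case/orP => [/sp->|/sq->]; rewrite ?orbT.
- by rewrite path_edges_cat count_cat /= lp addnA.
Qed.

(** A path inside [A] only sees the marks of pairs inside [A], so the marking may be changed freely
    elsewhere. *)
Lemma marked_path_mono F F' A B k x y :
  A \subset B -> {in A &, forall u v, F [set u; v] = F' [set u; v]} ->
  marked_path F A k x y -> marked_path F' B k x y.
Proof.
move=> sAB eF [p [pp lp Up sp <-]]; exists p; split=> //.
  by move=> v /sp; apply: (subsetP sAB).
elim: p x {pp lp Up} sp => [|z p IHp] x //= sp.
rewrite IHp => [|v vp]; last by apply: sp; rewrite inE vp orbT.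
by rewrite eF // sp ?inE ?eqxx ?orbT.
Qed.

Lemma marked_pathW F A B k x y :
  A \subset B -> marked_path F A k x y -> marked_path F B k x y.
Proof. by move=> sAB; apply: marked_path_mono. Qed.

Lemma marked_path_unmarked F x p :
  path adj x p -> uniq (x :: p) ->
  {in x :: p &, forall u v, F [set u; v] = false} ->
  marked_path F [set:: x :: p] 0 x (last x p).
Proof.
move=> pp Up F0; apply: (marked_path_mono (F := pred0) (subxx _)).
  by move=> u v; rewrite !in_set => up vp; rewrite F0.
exists p; split=> // [v|]; first by rewrite in_set.
exact: count_pred0.
Qed.

(** * Versatile sets and the addition of an ear *)

Definition versatile F A : Prop :=
  forall x y, x \in A -> y \in A -> x != y ->
    marked_path F A 0 x y /\ marked_path F A 1 x y.

Lemma versatile0 F A x y : versatile F A -> x \in A -> y \in A ->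
  marked_path F A 0 x y.
Proof.
move=> VA Ax Ay; have [->|nxy] := eqVneq x y; first exact: marked_path_refl.
by case: (VA x y Ax Ay nxy).
Qed.

Lemma versatile1 F A x y : versatile F A -> x \in A -> y \in A -> x != y ->
  marked_path F A 1 x y.
Proof. by move=> VA Ax Ay nxy; case: (VA x y Ax Ay nxy). Qed.

Lemma versatile_ext F F' A :
  {in A &, forall u v, F [set u; v] = F' [set u; v]} ->
  versatile F A -> versatile F' A.
Proof.
move=> eF VA x y Ax Ay nxy; have [H0 H1] := VA x y Ax Ay nxy.
by split; apply: marked_path_mono eF _.
Qed.

Section Ear.
Variables (F : pred {set G}) (A : {set G}) (a b x0 : G) (e : seq G).
Hypotheses (VA : versatile F A) (Aa : a \in A) (Ab : b \in A).
Hypotheses (a_x0 : adj a x0) (path_e : path adj x0 e) (uniq_e : uniq (x0 :: e)).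
Hypothesis (last_b : adj (last x0 e) b).
Hypothesis notA : {in x0 :: e, forall x, x \notin A}.
Hypothesis closed_ear : a = b -> e != [::].

(* An open ear stays unmarked; a closed ear gets one marked edge, so that its
   two ways around differ by exactly one mark. *)
Let F' : pred {set G} := fun s =>
  ((s \subset A) && F s) || ((a == b) && (s == [set a; x0])).

Let VA' : versatile F' A.
Proof.
apply: versatile_ext VA => u v Au Av; rewrite /F' subUset !sub1set Au Av /=.
case: (_ =P [set a; x0]) => [Es|_]; last by rewrite andbF orbF.
have : x0 \in [set u; v] by rewrite Es !inE eqxx orbT.
have nx0 : x0 \notin A by apply: notA; rewrite inE eqxx.
by rewrite !inE => /orP [] /eqP Ex; rewrite Ex ?Au ?Av in nx0.
Qed.

Let F'_out x y : x \in x0 :: e ->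
  F' [set y; x] = (a == b) && ([set y; x] == [set a; x0]).
Proof. by move=> /notA nx; rewrite /F' subUset !sub1set (negbTE nx) andbF. Qed.

(** Only for a closed ear is there a mark to avoid. By [closed_ear] its last vertex is then
    different from [x0], so its two end edges are different. *)
Let F'_right : F' [set last x0 e; b] = false.
Proof.
rewrite setUC F'_out ?mem_last //.
have [Eab|//] := eqVneq a b; rewrite -Eab /=.
apply/eqP => Es; have : last x0 e \in [set a; x0] by rewrite -Es !inE eqxx orbT.
have nl : last x0 e \notin A by apply: notA; rewrite mem_last.
rewrite !inE; case/orP => /eqP El; first by rewrite El Aa in nl.
move: (closed_ear Eab) El uniq_e; case: e => //= z s _ <-.
by rewrite mem_last.
Qed.

Let F'_left : F' [set x0; a] = (a == b).
Proof. by rewrite setUC F'_out ?inE eqxx // andbT. Qed.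

(** The only edge outside [A] that can be marked contains [a], which is not on the ear. *)
Let segment s1 y p s2 : x0 :: e = s1 ++ (y :: p) ++ s2 ->
  marked_path F' [set:: y :: p] 0 y (last y p).
Proof.
move=> Ee; apply: marked_path_unmarked.
- have : sorted adj (x0 :: e) by [].
  by rewrite Ee => /cat_sorted2[_ /cat_sorted2[]].
- by move: uniq_e; rewrite Ee !cat_uniq => /and3P[_ _ /andP[]].
- have sub v : v \in y :: p -> v \in x0 :: e.
    by move=> vp; rewrite Ee !mem_cat vp orbT.
  move=> u v /sub eu /sub ev; rewrite F'_out //.
  case: (_ =P [set a; x0]) => [Es|]; last by rewrite andbF.
  have : a \in [set u; v] by rewrite Es !inE eqxx.
  by rewrite !inE => /orP [] /eqP Ea; rewrite -Ea in eu ev;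
    [move: (notA eu) | move: (notA ev)]; rewrite Aa.
Qed.

Let segment_left s1 x s2 : x0 :: e = s1 ++ x :: s2 ->
  marked_path F' [set:: rcons s1 x] 0 x x0.
Proof.
move=> Ee; apply: marked_path_sym.
case: s1 Ee => [[-> _]|y s1 Ee]; first by apply: marked_path_refl; rewrite in_set inE.
have /segment : x0 :: e = [::] ++ (y :: rcons s1 x) ++ s2.
  by rewrite Ee /= cat_rcons.
by case: Ee => -> _; rewrite last_rcons.
Qed.

Let segment_right s1 x s2 : x0 :: e = s1 ++ x :: s2 ->
  marked_path F' [set:: x :: s2] 0 x (last x0 e).
Proof.
move=> Ee; have /segment : x0 :: e = s1 ++ (x :: s2) ++ [::] by rewrite cats0.
suff -> : last x0 e = last x s2 by [].
by rewrite -[last x0 e]/(last x0 (x0 :: e)) Ee last_cat.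
Qed.

Let disjoint_ear s : {subset s <= x0 :: e} -> [disjoint [set:: s] & A].
Proof.
move=> ss; rewrite disjoint_subset; apply/subsetP => v; rewrite in_set.
by move=> /ss /notA.
Qed.

Let via_left s1 x s2 k y : x0 :: e = s1 ++ x :: s2 -> marked_path F' A k a y ->
  marked_path F' ([set:: rcons s1 x] :|: A) ((a == b) + k) x y.
Proof.
move=> Ee Hk; apply: marked_path_step (segment_left Ee) _ Hk _.
- by apply: disjoint_ear => v vs; rewrite Ee -cat_rcons mem_cat vs.
- by rewrite adj_sym.
- by rewrite F'_left.
Qed.

Let via_right s1 x s2 k y : x0 :: e = s1 ++ x :: s2 -> marked_path F' A k b y ->
  marked_path F' ([set:: x :: s2] :|: A) k x y.
Proof.
move=> Ee Hk; apply: marked_path_step (segment_right Ee) last_b Hk _.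
- by apply: disjoint_ear => v vs; rewrite Ee mem_cat vs orbT.
- by rewrite F'_right.
Qed.

Let AE := A :|: [set:: x0 :: e].

Let sub_ear s : {subset s <= x0 :: e} -> [set:: s] :|: A \subset AE.
Proof.
move=> ss; rewrite setUC setUS //; apply/subsetP=> v; rewrite !in_set.
exact: ss.
Qed.

(** Leaving the ear through [b] costs no mark, leaving through [a] costs one exactly when the ear is
    closed. A closed ear gets its one mark there. On an open ear the mark comes from the path in [A]
    starting at [b], or from the one starting at [a] when [y = b]. *)
Let ear_to_A x y : x \in x0 :: e -> y \in A ->
  marked_path F' AE 0 x y /\ marked_path F' AE 1 x y.
Proof.
move=> ex Ay; have [s1 [s2 Ee]] := mem_cat_cons ex.
have L k : marked_path F' A k a y -> marked_path F' AE ((a == b) + k) x y.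
  move=> /(via_left Ee); apply: marked_pathW; apply: sub_ear => v.
  by rewrite Ee -cat_rcons mem_cat => ->.
have R k : marked_path F' A k b y -> marked_path F' AE k x y.
  move=> /(via_right Ee); apply: marked_pathW; apply: sub_ear => v.
  by rewrite Ee mem_cat => ->; rewrite orbT.
split; first by apply: R; apply: versatile0.
have [Eab|nab] := eqVneq a b.
  by move: (L 0); rewrite Eab eqxx; apply; apply: versatile0.
have [Eyb|nyb] := eqVneq b y; last by apply: R; apply: versatile1.
by move: (L 1); rewrite (negbTE nab); apply; apply: versatile1; rewrite -?Eyb.
Qed.

(** The stretch of the ear between [x] and [y] is unmarked. The path with one mark goes the other
    way: back from [x] to [a], through [A] to [b], then backwards along the ear to [y]. *)
Let ear_to_ear s1 x s2 y s3 : x0 :: e = s1 ++ x :: s2 ++ y :: s3 ->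
  marked_path F' AE 0 x y /\ marked_path F' AE 1 x y.
Proof.
move=> Ex; have Ey : x0 :: e = (s1 ++ x :: s2) ++ y :: s3 by rewrite -catA.
split.
  have E2 : x0 :: e = s1 ++ (x :: rcons s2 y) ++ s3 by rewrite Ex /= cat_rcons.
  have := segment E2; rewrite last_rcons; apply: marked_pathW; apply: subset_trans (sub_ear _).
    exact: subsetUl.
  by move=> v vs; rewrite E2 !mem_cat vs !orbT.
(* The mark lies on the edge from [a] to [x0] if the ear is closed, and on the path inside [A]
   otherwise. *)
have Hab : exists2 k, (a == b) + k = 1 & marked_path F' A k a b.
  have [<-|nab] := eqVneq a b; first by exists 0 => //; apply: marked_path_refl.
  by exists 1 => //; apply: versatile1.
case: Hab => k Ek /(via_left Ex); rewrite {}Ek => Hxb.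
move: uniq_e; rewrite Ey cat_uniq => /and3P[_ /hasPn d1 _].
have dxy : [disjoint [set:: rcons s1 x] :|: A & [set:: y :: s3]].
  rewrite disjointsUl [X in _ && X]disjoint_sym disjoint_ear ?andbT; last first.
    by move=> v vs; rewrite Ey mem_cat vs orbT.
  rewrite disjoint_sym disjoints_subset; apply/subsetP => v.
  rewrite in_setC !in_set => /d1; apply: contra.
  by rewrite -cat_rcons mem_cat => ->.
suff : marked_path F' ([set:: rcons s1 x] :|: A :|: [set:: y :: s3]) 1 x y.
  apply: marked_pathW; rewrite setUC setUA -setUA setUC; apply/subsetP => v.
  rewrite !in_set Ex -(cat_rcons x) !mem_cat -orbA.
  by case/or3P => ->; rewrite ?orbT.
apply: (marked_path_step dxy Hxb (z := last x0 e)).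
- by rewrite adj_sym.
- exact: marked_path_sym (segment_right Ey).
- by rewrite setUC F'_right.
Qed.

Lemma versatile_ear : exists F0, versatile F0 (A :|: [set:: x0 :: e]).
Proof.
exists F' => x y; rewrite in_setU [y \in _]in_setU !in_set.
have sym u v : marked_path F' AE 0 u v /\ marked_path F' AE 1 u v ->
    marked_path F' AE 0 v u /\ marked_path F' AE 1 v u.
  by case; split; apply: marked_path_sym.
case/orP => [Ax|ex] /orP[Ay|ey] nxy; last first.
- have [s1 [s2 Ex]] := mem_cat_cons ex.
  rewrite Ex mem_cat inE eq_sym (negbTE nxy) /= in ey; case/orP: ey => sy.
    have [s3 [s4 Ey]] := mem_cat_cons sy.
    by apply: sym; apply: (ear_to_ear (s1 := s3) (s2 := s4) (s3 := s2)); rewrite Ex Ey -catA.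
  have [s3 [s4 Ey]] := mem_cat_cons sy.
  by apply: (ear_to_ear (s1 := s1) (s2 := s3) (s3 := s4)); rewrite Ex Ey.
- exact: ear_to_A.
- by apply: sym; apply: ear_to_A.
- by split; apply: marked_pathW (subsetUl _ _) _; [apply: versatile0|apply: versatile1].
Qed.

End Ear.

(** * Bridgeless sets are versatile *)

Definition bridgeless S :=
  {in S &, forall x y, adj x y -> connect (del_edge_adj [set x; y]) x y}.

(** Starting from the gate [b], the set [A] grows by ears. An edge from [A] into the rest of [S] is
    no bridge, so it extends to an ear returning to [A]; the ear cannot leave [S], as it could only
    do so from [b], which is already in [A]. *)
Lemma versatile_bridgeless S b :
  connected G -> b \in S -> (forall x y, x \in S -> y \notin S -> adj x y -> x = b) ->
  bridgeless S -> exists F, versatile F S.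
Proof.
move=> conG Sb gate brS.
suff grow n A : #|S :\: A| <= n -> b \in A -> A \subset S ->
    (exists F, versatile F A) -> exists F, versatile F S.
  apply: (grow _ [set b] (leqnn _)); rewrite ?sub1set ?inE //.
  by exists pred0 => x y; rewrite !inE => /eqP-> /eqP->; rewrite eqxx.
elim: n A => [|n IHn] A.
  rewrite leqn0 cards_eq0 setD_eq0 => sSA _ sAS exF.
  by have -> : S = A by apply/eqP; rewrite eqEsubset sSA.
move=> le_n Ab sAS exF.
have [/existsP[x /existsP[y /and4P[Ax nAy Sy xy]]]|noedge] :=
  boolP [exists x, exists y, [&& x \in A, y \notin A, y \in S & adj x y]]; last first.
  have [sSA|/subsetPn[z Sz nAz]] := boolP (S \subset A).
    by have -> : S = A by apply/eqP; rewrite eqEsubset sSA.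
  (* With no edge between [A] and [S :\: A], the latter could only be left through [b], which is not
     in it. This contradicts connectedness. *)
  have clos : closed adj (mem (S :\: A)).
    apply: intro_closed; first exact: sym_connect_sym (@adj_sym G).
    move=> u v uv; rewrite !inE => /andP[nAu Su].
    have Sv : v \in S.
      by apply: contraR nAu => nSv; rewrite (gate u v).
    rewrite Sv andbT; apply: contra noedge => Av.
    by apply/existsP; exists v; apply/existsP; exists u; rewrite Av nAu Su adj_sym.
  by have := closed_connect clos (conG z b); rewrite !inE Ab Sz nAz.
have : connect (del_edge_adj [set x; y]) y x.
  rewrite (sym_connect_sym (@del_edge_sym G [set x; y])).
  by apply: brS => //; apply: (subsetP sAS).
case/connectP => p0 pth0 lst0; move: Ax lst0.
case/shortenP: pth0 => p pth Up _ Ax lst.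
have hasA : has (mem A) p.
  apply/hasP; exists x => //; have := mem_last y p; rewrite -lst inE.
  by case/orP => // /eqP Exy; rewrite -Exy Ax in nAy.
(* The way back from [y] is cut at its first vertex [c] in [A]; the ear is [y :: p1], attached at
   [x] and [c]. *)
case: (split_find hasA) pth Up {lst} => c p1 p2 Ac nA1.
rewrite cat_path rcons_path last_rcons => /andP[/andP[pth1 ec] _].
rewrite -cat_cons cat_uniq -rcons_cons rcons_uniq => /andP[/andP[_ U1] _].
have notA : {in y :: p1, forall v, v \notin A}.
  by move=> v; rewrite inE => /predU1P[-> //|vp]; apply: contra nA1 => Av;
    apply/hasP; exists v.
have adj1 : path adj y p1 by apply: sub_path pth1 => u v /andP[].
have sub1 : {subset y :: p1 <= S}.
  elim: p1 y Sy adj1 notA {pth1 ec U1 nA1 nAy xy} => [|w s IHs] y Sy /=.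
    by move=> _ _ v; rewrite inE => /eqP->.
  case/andP=> yw ps nA v; rewrite inE => /predU1P[-> //|].
  apply: IHs => // [|u us]; last by apply: nA; rewrite inE us orbT.
  apply: contraLR (Ab) => nSw; rewrite -(gate y w) //.
  by apply: nA; rewrite inE eqxx.
case: exF => F VA; apply: (IHn (A :|: [set:: y :: p1])).
- rewrite -ltnS; apply: leq_trans le_n; apply: proper_card.
  apply/properP; split; first by rewrite setDS // subsetUl.
  by exists y; rewrite !inE ?eqxx ?orbT // nAy.
- by rewrite inE Ab.
- by rewrite subUset sAS; apply/subsetP => v; rewrite in_set => /sub1.
- apply: (versatile_ear VA Ax Ac xy adj1 U1) => //; first by case/andP: ec.
  (* A closed ear with the single vertex [y] would return along the deleted edge. *)
  move=> Exc; apply/eqP => p10; move: ec; rewrite p10 -Exc /del_edge_adj /=.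
  by rewrite setUC eqxx andbF.
Qed.

(** * Sides of bridges *)

(** In a connected graph [S] is the side containing [b] of the bridge [ab]. The boolean form allows
    the use of [minset]. *)
Definition pendant a b S : bool :=
  [&& a \notin S, b \in S, adj a b &
    [forall x in S, forall (y | y \notin S), adj x y ==> (x == b) && (y == a)]].

Lemma pendantP a b S :
  reflect [/\ a \notin S, b \in S, adj a b &
             forall x y, x \in S -> y \notin S -> adj x y -> x = b /\ y = a]
          (pendant a b S).
Proof.
apply: (iffP and4P) => -[nSa Sb ab H]; split=> //.
  move=> x y Sx nSy xy; move/forall_inP: H => /(_ x Sx) /forall_inP /(_ y nSy).
  by rewrite xy => /andP[/eqP-> /eqP->].
apply/forall_inP => x Sx; apply/forall_inP => y nSy; apply/implyP => xy.
by have [-> ->] := H x y Sx nSy xy; rewrite !eqxx.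
Qed.

Lemma pendantC a b S : pendant a b S -> pendant b a (~: S).
Proof.
case/pendantP => nSa Sb ab H; apply/pendantP; split; rewrite ?inE ?negbK //.
  by rewrite adj_sym.
by move=> x y; rewrite !inE negbK adj_sym => nSx Sy /(H y x Sy nSx)[].
Qed.

(** An edge leaving [S :&: T] either leaves [T], and is then [xy], or stays in [T] and leaves [S];
    the latter would end at [a], which is not in [T]. *)
Lemma pendantI a b S x y T :
  pendant a b S -> pendant x y T -> x \in S -> y \in S -> a \notin T ->
  pendant x y (S :&: T).
Proof.
case/pendantP => nSa Sb ab HS /pendantP[nTx Ty xy HT] Sx Sy nTa.
apply/pendantP; split; rewrite ?inE ?Sy ?(negbTE nTx) ?andbF //.
move=> u v; rewrite !inE => /andP[Su Tu]; rewrite negb_and.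
have [Tv|nTv] := boolP (v \in T); last by move=> _; apply: HT.
rewrite orbF => nSv uv; case: (HS u v Su nSv uv) => _ Ev.
by rewrite Ev (negbTE nTa) in Tv.
Qed.

Lemma bridge_pendant x y :
  adj x y -> ~~ connect (del_edge_adj [set x; y]) x y ->
  pendant x y [set z | connect (del_edge_adj [set x; y]) y z].
Proof.
move=> xy br; have cs := sym_connect_sym (@del_edge_sym G [set x; y]).
have nSx : x \notin [set z | connect (del_edge_adj [set x; y]) y z].
  by rewrite inE cs.
have Sy : y \in [set z | connect (del_edge_adj [set x; y]) y z].
  by rewrite inE.
apply/pendantP; split=> // u v Su nSv uv.
have Euv : [set u; v] = [set x; y].
  apply/eqP; apply: contraR nSv => nuv; rewrite inE; move: Su; rewrite inE.
  by move=> yu; apply: connect_trans yu (connect1 _); rewrite /del_edge_adj uv.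
have : u \in [set x; y] by rewrite -Euv !inE eqxx.
have : v \in [set x; y] by rewrite -Euv !inE eqxx orbT.
rewrite !inE => /pred2P Ev /pred2P Eu; split.
  by case: Eu => // Eu; move: nSx; rewrite -{1}Eu Su.
by case: Ev => // Ev; rewrite Ev Sy in nSv.
Qed.

(* A bridge inside S would have a side not containing a; by pendantI the trace
   of that side on S is a smaller pendant set. *)
Lemma min_pendant_bridgeless S :
  minset (fun T => [exists a, exists b, pendant a b T]) S -> bridgeless S.
Proof.
case/minsetP => /existsP[a /existsP[b pS]] minS x y Sx Sy xy.
apply: contraT => br; pose T := [set z | connect (del_edge_adj [set x; y]) y z].
have pT : pendant x y T by apply: bridge_pendant.
(* By minimality the trace [S :&: T'] would be all of [S], yet it misses [u]. *)
have absurd u v (T' : {set G}) : u \in S -> v \in S -> a \notin T' -> ~~ pendant u v T'.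
  move=> Su Sv naT'; apply/negP => pT'; have pI := pendantI pS pT' Su Sv naT'.
  case/pendantP: pT' => nT'u _ _ _.
  have ES : S :&: T' = S.
    apply: minS; last exact: subsetIl.
    by apply/existsP; exists u; apply/existsP; exists v.
  by move: Su nT'u; rewrite -{1}ES inE => /andP[_ ->].
have [Ta|nTa] := boolP (a \in T).
  by have := absurd y x (~: T) Sy Sx; rewrite pendantC // inE Ta => /(_ isT).
by have := absurd x y T Sx Sy nTa; rewrite pT.
Qed.

(** The vertex [b] has a neighbour [z] other than [a]. It lies in [S], and since it is not [b], all
    of its at least two neighbours lie in [S] as well. *)
Lemma card_pendant a b S :
  (forall x, 1 < degree x) -> pendant a b S -> 2 < #|S|.
Proof.
move=> deg /pendantP[nSa Sb ab HS].
have /card_gt1P[c [d []]] := deg b; rewrite !inE => bc bd ncd.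
have [z bz nza] : exists2 z, adj b z & z != a.
  have [Eca|nca] := eqVneq c a; last by exists c.
  by exists d => //; rewrite eq_sym -Eca.
have Sz : z \in S by apply: contraR nza => nSz; case: (HS b z Sb nSz bz) => _ ->.
have sub : z |: [set y | adj z y] \subset S.
  apply/subsetP => v; rewrite !inE => /predU1P[-> //|zv].
  apply: contraT => nSv; case: (HS z v Sz nSv zv) => Ezb _.
  by rewrite Ezb adj_irr in bz.
apply: leq_trans (subset_leq_card sub).
by rewrite cardsU1 inE adj_irr add1n ltnS; apply: deg.
Qed.

(** * Marking a graph with at most eight vertices *)

(** Each part keeps its own marking, and [st] is the only marked edge elsewhere. As [st] lies in
    neither part, it disturbs neither marking. *)
Lemma versatile_glue F1 F2 A B s t :
  [disjoint A & B] -> versatile F1 A -> versatile F2 B ->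
  ~~ ([set s; t] \subset A) -> ~~ ([set s; t] \subset B) ->
  exists F, [/\ versatile F A, versatile F B &
    forall e : {set G}, ~~ (e \subset A) -> ~~ (e \subset B) -> F e = (e == [set s; t])].
Proof.
move=> dAB VA VB nA nB.
exists (fun e : {set G} => [|| (e \subset A) && F1 e, (e \subset B) && F2 e | e == [set s; t]]).
split; last by move=> e /negbTE-> /negbTE->.
- apply: versatile_ext VA => u v Au Av.
  have eA : [set u; v] \subset A by rewrite subUset !sub1set Au Av.
  rewrite eA subUset sub1set (disjointFr dAB Au) /=.
  by case: eqP => [E|_]; [rewrite -E eA in nA|rewrite orbF].
- apply: versatile_ext VB => u v Bu Bv.
  have eB : [set u; v] \subset B by rewrite subUset !sub1set Bu Bv.
  rewrite eB subUset sub1set (disjointFl dAB Bu) /=.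
  by case: eqP => [E|_]; [rewrite -E eB in nB|rewrite orbF].
Qed.

(** Adjacent pairs are exempt because a single edge is conflict-free whatever its colour. *)
Lemma exists_one_mark_coloring :
  connected G -> (forall x, 1 < degree x) -> #|G| <= 8 ->
  exists F, forall x y, x != y -> adj x y \/ marked_path F setT 1 x y.
Proof.
move=> conG deg leG8.
pose P T := [exists a, exists b, @pendant a b T].
have [/existsP[U0 PU0]|noP] := boolP [exists T, P T]; last first.
  (* Without a bridge the whole vertex set is bridgeless, with an arbitrary gate [r]. *)
  have [/existsP[r _]|noV] := boolP [exists x : G, true]; last first.
    by exists pred0 => x; case/existsP: noV; exists x.
  have [||F VF] := versatile_bridgeless conG (in_setT r).
  - by move=> x y _; rewrite inE.
  - move=> x y _ _ xy; apply: contraR noP => /(bridge_pendant xy) pT.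
    apply/existsP; eexists; apply/existsP; exists x; apply/existsP; exists y.
    exact: pT.
  by exists F => x y nxy; right; apply: versatile1; rewrite ?inE.
have [U minU _] := minset_exists PU0.
case/minsetP: (minU) => /existsP[v /existsP[u pU]] _.
have PU' : P (~: U).
  by apply/existsP; exists u; apply/existsP; exists v; apply: pendantC.
have [W minW sWU] := minset_exists PU'.
case/minsetP: (minW) => /existsP[p /existsP[q pW]] _.
have U3 := card_pendant deg pU; have W3 := card_pendant deg pW.
case/pendantP: pU => nUv Uu vu HU; case/pendantP: pW => nWp Wq pq HW.
have [|F1 V1] := versatile_bridgeless conG Uu _ (min_pendant_bridgeless minU).
  by move=> x y Ux nUy xy; case: (HU x y).
have [|F2 V2] := versatile_bridgeless conG Wq _ (min_pendant_bridgeless minW).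
  by move=> x y Wx nWy xy; case: (HW x y).
have dUW : [disjoint U & W] by rewrite disjoint_sym disjoints_subset.
have nUW x : x \in U -> x \notin W by move=> Ux; rewrite (disjointFr dUW Ux).
have nWU x : x \in W -> x \notin U by move=> Wx; rewrite (disjointFl dUW Wx).
have [M defM] : exists M, M = ~: (U :|: W) by exists (~: (U :|: W)).
have inM x : (x \in M) = (x \notin U) && (x \notin W).
  by rewrite defM !inE negb_or.
have M2 : #|M| <= 2.
  rewrite defM -(leq_add2l #|U :|: W|) cardsC cardsU disjoint_setI0 // cards0 subn0.
  apply: leq_trans leG8 _.
  by rewrite -[8]/(3 + 3 + 2) leq_add2r leq_add.
have nbrM x y : x \in M -> adj x y ->
    [\/ x = v /\ y = u, x = p /\ y = q | y \in M].
  rewrite !inM adj_sym => /andP[nUx nWx] xy.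
  have [Uy|nUy] := boolP (y \in U); first by constructor 1; case: (HU y x).
  have [Wy|nWy] := boolP (y \in W); first by constructor 2; case: (HW y x).
  by constructor 3.
(* Any other vertex of [M] would have all its neighbours in [M], giving [M] at least three
   vertices. *)
have M_vp x : x \in M -> x = v \/ x = p.
  move=> Mx; have [->|nxv] := eqVneq x v; first by left.
  have [->|nxp] := eqVneq x p; first by right.
  have : x |: [set y | adj x y] \subset M.
    apply/subsetP => y; rewrite !inE => /predU1P[-> //|xy].
    by case: (nbrM x y Mx xy) => [[Ex]|[Ex]|//]; rewrite Ex eqxx in nxv nxp.
  move=> /subset_leq_card; rewrite cardsU1 inE adj_irr add1n => /leq_trans/(_ M2).
  by rewrite leqNgt ltnS (deg x).
have cover x : [\/ x \in U, x \in W | x \in M].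
  have [Ux|nUx] := boolP (x \in U); first by constructor 1.
  have [Wx|nWx] := boolP (x \in W); first by constructor 2.
  by constructor 3; rewrite inM nUx.
pose R F x y := adj x y \/ marked_path F setT 1 x y.
have symR F x y : R F x y -> R F y x.
  by case=> [|/marked_path_sym]; [left; rewrite adj_sym|right].
have toT F A x y : marked_path F A 1 x y -> R F x y.
  by move=> H; right; apply: marked_pathW (subsetT A) H.
have reduce F : versatile F U -> versatile F W ->
    (forall x y, x \in U -> y \in W -> R F x y) ->
    (forall x y, x \in M -> x != y -> R F x y) ->
  forall x y, x != y -> R F x y.
  move=> VU VW RUW RM x y nxy.
  case: (cover x) => [Ux|Wx|Mx]; last exact: RM.
    case: (cover y) => [Uy|Wy|My]; last by apply: symR; apply: RM; rewrite 1?eq_sym.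
      exact: toT (versatile1 VU Ux Uy nxy).
    exact: RUW.
  case: (cover y) => [Uy|Wy|My]; last by apply: symR; apply: RM; rewrite 1?eq_sym.
    by apply: symR; apply: RUW.
  exact: toT (versatile1 VW Wx Wy nxy).
(* First case: [M] is empty and the bridge [uv] joins [U] to [W]; this bridge is marked. *)
have [Wv|nWv] := boolP (v \in W).
  have [Ev Eu] := HW v u Wv (nUW u Uu) vu.
  have [||F [VU VW HF]] := versatile_glue (s := u) (t := v) dUW V1 V2.
  - by rewrite subUset !sub1set (negbTE nUv) andbF.
  - by rewrite subUset !sub1set (negbTE (nUW u Uu)).
  have Fuv : F [set u; v].
    by rewrite HF ?eqxx // subUset !sub1set ?(negbTE nUv) ?(negbTE (nUW u Uu)) ?andbF.
  exists F; apply: reduce => // [x y Ux Wy|x y Mx _].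
    apply: toT; apply: marked_path_step dUW (versatile0 VU Ux Uu) _
      (versatile0 VW Wv Wy) _; by rewrite ?Fuv // adj_sym.
  by move: Mx (Mx) => /M_vp[]->; rewrite inM ?Wv ?andbF // -Eu Uu.
have nUp : p \notin U.
  apply/negP => Up; have [_ Eq] := HU p q Up (nWU q Wq) pq.
  by rewrite -Eq Wq in nWv.
have Mv : v \in M by rewrite inM nUv.
have Mp : p \in M by rewrite inM nUp.
have uv : adj u v by rewrite adj_sym.
have nvu : v != u by apply: contraNneq nUv => ->.
have nUq := nWU q Wq.
(* Second case: [v] is the only vertex of [M]. The edge [uv] is marked and [vq] is not, so paths
   from [v] into [W] take their mark inside [W], except that [q] is adjacent to [v]. *)
have [Evp|nvp] := eqVneq v p.
  have [||F [VU VW HF]] := versatile_glue (s := u) (t := v) dUW V1 V2.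
  - by rewrite subUset !sub1set (negbTE nUv) andbF.
  - by rewrite subUset !sub1set (negbTE nWv) andbF.
  have Fuv : F [set u; v].
    by rewrite HF ?eqxx // subUset !sub1set ?(negbTE nUv) ?(negbTE nWv) ?andbF.
  have Fvq : F [set v; q] = false.
    rewrite HF ?subUset ?sub1set ?(negbTE nUv) ?(negbTE nWv) //.
    apply/eqP => E; have : q \in [set u; v] by rewrite -E !inE eqxx orbT.
    by rewrite !inE => /pred2P[] Eq; [rewrite Eq Uu in nUq|rewrite Eq (negbTE nWv) in Wq].
  rewrite -Evp in pq.
  have Uv : forall x, x \in U -> marked_path F (U :|: [set v]) 1 x v.
    move=> x Ux; apply: marked_path_step (versatile0 VU Ux Uu) uv
      (marked_path_refl F (set11 v)) _; last by rewrite Fuv.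
    by rewrite disjoint_sym disjoints1.
  exists F; apply: reduce => // [x y Ux Wy|x y Mx nxy].
    apply: toT; apply: marked_path_step (Uv x Ux) pq (versatile0 VW Wq Wy) _.
      by rewrite disjointsUl dUW disjoints1.
    by rewrite Fvq.
  have Ex : x = v by case: (M_vp x Mx) => // ->.
  rewrite {x Mx}Ex in nxy *.
  case: (cover y) => [Uy|Wy|/M_vp].
  - by apply: symR; apply: toT (Uv y Uy).
  - have [<-|nqy] := eqVneq q y; first by left.
    apply: toT; apply: marked_path_step (marked_path_refl F (set11 v)) pq
      (versatile1 VW Wq Wy nqy) _; first by rewrite disjoints1.
    by rewrite Fvq.
  - by rewrite -Evp => -[] Ey; rewrite Ey eqxx in nxy.
(* Third case: [M] consists of [v] and [p]. A second neighbour of [v] can only be [p], and the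
   middle edge [vp] of the path [u, v, p, q] gets the mark. *)
have vp : adj v p.
  have /card_gt1P[c [d []]] := deg v; rewrite !inE => vc vd ncd.
  have [z vz nzu] : exists2 z, adj v z & z != u.
    have [Ecu|ncu] := eqVneq c u; last by exists c.
    by exists d => //; rewrite eq_sym -Ecu.
  case: (nbrM v z Mv vz) => [[_ Ez]|[Ev]|/M_vp[] Ez].
  - by rewrite Ez eqxx in nzu.
  - by rewrite Ev eqxx in nvp.
  - by rewrite Ez adj_irr in vz.
  - by rewrite -Ez.
have [||F [VU VW HF]] := versatile_glue (s := v) (t := p) dUW V1 V2.
- by rewrite subUset !sub1set (negbTE nUv).
- by rewrite subUset !sub1set (negbTE nWv).
have Fvp : F [set v; p].
  by rewrite HF ?eqxx // subUset !sub1set ?(negbTE nUv) ?(negbTE nWv).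
have Fuv : F [set u; v] = false.
  rewrite HF ?subUset ?sub1set ?(negbTE nUv) ?(negbTE nWv) ?andbF //.
  apply/eqP => E; have : u \in [set v; p] by rewrite -E !inE eqxx.
  by rewrite !inE => /pred2P[] Eu; rewrite -Eu ?Uu // in nUv nUp.
have Fpq : F [set p; q] = false.
  rewrite HF ?subUset ?sub1set ?(negbTE nUp) ?(negbTE nWp) ?andbF //.
  apply/eqP => E; have : q \in [set v; p] by rewrite -E !inE eqxx orbT.
  by rewrite !inE => /pred2P[] Eq; rewrite -Eq ?Wq // in nWv nWp.
have Uv : forall k x, marked_path F U k x u -> marked_path F (U :|: [set v]) k x v.
  move=> k x Hx; apply: marked_path_step Hx uv (marked_path_refl F (set11 v)) _.
    by rewrite disjoint_sym disjoints1.
  by rewrite Fuv !addn0.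
have pW k y : marked_path F W k q y -> marked_path F ([set p] :|: W) k p y.
  move=> Hy; apply: marked_path_step (marked_path_refl F (set11 p)) pq Hy _.
    by rewrite disjoints1.
  by rewrite Fpq.
exists F; apply: reduce => // [x y Ux Wy|x y].
  apply: toT; apply: marked_path_step (Uv _ _ (versatile0 VU Ux Uu)) vp
    (pW _ _ (versatile0 VW Wq Wy)) _; last by rewrite Fvp.
  rewrite disjoint_sym !disjointsUl disjoints1 !inE negb_or nUp eq_sym nvp /=.
  by rewrite disjoint_sym disjointsUl dUW disjoints1.
move=> /M_vp[]-> nxy; case: (cover y) => [Uy|Wy|/M_vp[] Ey].
- apply: symR; have [->|nyu] := eqVneq y u; first by left.
  exact: toT (Uv _ _ (versatile1 VU Uy Uu nyu)).
- apply: toT; apply: marked_path_step (marked_path_refl F (set11 v)) vp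
    (pW _ _ (versatile0 VW Wq Wy)) _; last by rewrite Fvp.
  by rewrite disjoints1 !inE negb_or nvp.
- by rewrite Ey eqxx in nxy.
- by left; rewrite Ey.
- apply: symR; apply: toT; apply: marked_path_step (Uv _ _ (versatile0 VU Uy Uu)) vp
    (marked_path_refl F (set11 p)) _; last by rewrite Fvp.
  by rewrite disjoint_sym disjoints1 !inE negb_or nUp eq_sym.
- have [<-|nqy] := eqVneq q y; first by left.
  exact: toT (pW _ _ (versatile1 VW Wq Wy nqy)).
- by left; rewrite Ey adj_sym.
- by rewrite Ey eqxx in nxy.
Qed.

(** * From markings to the number of colours *)

Lemma path_edges_sub x p : path adj x p -> {subset path_edges x p <= edges G}.
Proof.
elim: p x => //= y p IHp x /andP[xy py] e; rewrite inE => /predU1P[->|].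
  by apply/imsetP; exists (x, y); rewrite ?inE.
exact: IHp.
Qed.

(** A path between two nonadjacent vertices has at least two edges. The colour used once on it
    therefore differs from that of another edge. *)
Lemma num_colors_gt1 (c : {set G} -> nat) :
  ~ complete G -> cfc_coloring c -> 1 < num_colors c.
Proof.
move=> ncG cfc.
have [/existsP[x /existsP[y /andP[nxy nadj]]]|none] :=
  boolP [exists x : G, exists y : G, (x != y) && ~~ adj x y]; last first.
  case: ncG => x y nxy; apply: contraR none => nadj.
  by apply/existsP; exists x; apply/existsP; exists y; rewrite nxy.
have [p [pth lst _ [a count_a]]] := cfc x y nxy.
have p2 : 1 < size (map c (path_edges x p)).
  rewrite size_map size_pairmap.
  case: p pth lst {count_a} => [|z [|]] //= => [_ Exy|]; first by rewrite Exy eqxx in nxy.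
  by rewrite andbT => xz Ezy; rewrite -Ezy xz in nadj.
have sub i : i \in map c (path_edges x p) -> i \in undup [seq c e | e in edges G].
  case/mapP => e /(path_edges_sub pth) Ee ->; rewrite mem_undup.
  by apply/mapP; exists e; rewrite ?mem_enum.
have /hasP[i ip nia] : has (predC (pred1 a)) (map c (path_edges x p)).
  by rewrite has_count -(ltn_add2l (count_mem a (map c (path_edges x p))))
    count_predC addn0 count_a.
have ap : a \in map c (path_edges x p) by rewrite -has_pred1 has_count count_a.
apply: (@uniq_leq_size _ [:: a; i]); first by rewrite /= inE eq_sym andbT.
by move=> j; rewrite !inE => /pred2P[]->; apply: sub.
Qed.

End MarkedPaths.

Lemma min_degree_le (G : sgraph) (x : G) : min_degree G <= degree x.
Proof.
rewrite /min_degree; have := mem_index_enum x.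
elim: (index_enum G) => //= y r IHr; rewrite big_cons inE => /predU1P[<-|/IHr le_x].
  exact: geq_minl.
exact: leq_trans (geq_minr _ _) le_x.
Qed.

Theorem theorem4p3 (G : sgraph) (n : nat) :
  connected G -> ~ complete G -> #|G| = n -> 4 <= n <= 8 ->
  linear_forest (cut_edge_graph G) -> 2 <= min_degree G ->
  is_cfc G 2.
Proof.
move=> conG ncG <- /andP[_ le8] _ deg2.
have deg (x : G) : 1 < degree x by apply: leq_trans deg2 (min_degree_le x).
have [F HF] := exists_one_mark_coloring conG deg le8.
split; last by move=> c; apply: num_colors_gt1.
pose c (e : {set G}) := nat_of_bool (F e).
have cfc : cfc_coloring c.
  move=> x y nxy; case: (HF x y nxy) => [xy|[p [pth lst Up _ cnt]]].
    exists [:: y]; split; rewrite /= ?xy ?inE ?nxy //.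
    by exists (c [set x; y]); rewrite /= eqxx.
  (* Marked edges have colour 1, so this colour occurs exactly once on the path. *)
  exists p; split=> //; exists 1; rewrite count_map -[RHS]cnt.
  by apply: eq_count => e; rewrite /= /c; case: (F e).
exists c; split=> //; apply/eqP; rewrite eqn_leq num_colors_gt1 // andbT.
apply: (@uniq_leq_size _ _ [:: 0; 1]); first exact: undup_uniq.
by move=> i; rewrite mem_undup => /mapP[e _ ->]; rewrite /c; case: (F e).
Qed.
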